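(* Let $1 \le p < \infty$ and $n\ge1$. Then $$U(n,p) \le \prod_{k=1}^n w(k,p).$$
   Context: Let $q = 1/p$ (with $0^q=0$). For $n\ge 1$, $U(n,p)$ denotes the maximum of $\mathrm{per}(A)=\sum_{\sigma\in S_n}\prod_{i=1}^n a_{i\sigma(i)}$ over all real $n\times n$ matrices $A$ each of whose rows has $\ell_p$-norm equal to $1$. For $k\ge1$ let $\Delta_k=\{y\in\mathbb R^k: y_i\ge 0,\ \sum_i y_i=1\}$ be the set of stochastic vectors, and define $P_k(y) = \sum_{i=1}^k y_i^q \prod_{j\ne i}(1-y_j)^q$ for $y\in\Delta_k$. Then $w(k,p)=\max_{y\in\Delta_k} P_k(y)$. *)

(* Defs.v *)
From HB Require Import structures.
From mathcomp Require Import all_boot all_order all_algebra perm.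
From mathcomp Require Import classical_sets reals exp.
Set Implicit Arguments. Unset Strict Implicit. Unset Printing Implicit Defensive.
Import Order.TTheory GRing.Theory Num.Theory.
Local Open Scope classical_set_scope.
Local Open Scope ring_scope.

Definition permanent (R : realType) (n : nat) (A : 'M[R]_n) : R :=
  \sum_(s : 'S_n) \prod_(i < n) A i (s i).

Definition row_lp_norm (R : realType) (n : nat) (p : R) (A : 'M[R]_n) (i : 'I_n) : R :=
  (\sum_(j < n) `|A i j| `^ p) `^ (1 / p).

(* U(n,p): the maximum (= supremum, attained by compactness) of per(A) over
   real n x n matrices all of whose rows have l_p-norm 1 *)
Definition U (R : realType) (n : nat) (p : R) : R :=
  sup [set permanent A | A in [set A : 'M[R]_n | forall i, row_lp_norm p A i = 1]].

Definition stochastic (R : realType) (k : nat) (y : 'rV[R]_k) : Prop :=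
  (forall i, 0 <= y ord0 i) /\ \sum_(i < k) y ord0 i = 1.

(* P_k(y) = sum_i y_i^q prod_{j <> i} (1 - y_j)^q with q = 1/p, 0^q = 0 *)
Definition Pk (R : realType) (k : nat) (p : R) (y : 'rV[R]_k) : R :=
  \sum_(i < k) (y ord0 i `^ (1 / p) *
                \prod_(j < k | j != i) (1 - y ord0 j) `^ (1 / p)).

(* w(k,p) = max over the simplex of P_k (as a supremum; attained by compactness) *)
Definition w (R : realType) (k : nat) (p : R) : R :=
  sup [set Pk p y | y in [set y : 'rV[R]_k | stochastic y]].

(* Main.v *)
From HB Require Import structures.
From mathcomp Require Import all_boot all_order all_algebra perm.
From mathcomp Require Import boolp classical_sets functions reals.
From mathcomp Require Import topology normedtype sequences derive exp.
From mathcomp Require Import ring lra.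
Require Import Defs.
Set Implicit Arguments. Unset Strict Implicit. Unset Printing Implicit Defensive.
Import Order.TTheory GRing.Theory Num.Theory.
Local Open Scope classical_set_scope.
Local Open Scope ring_scope.
Import numFieldNormedType.Exports.

(* Let A maximise the permanent among matrices whose rows have unit l_p-norm
   (it exists by compactness).  Multiplying one entry a_ij by e^t and
   renormalising its row cannot increase per A; differentiating at t = 0 gives
   the stationarity condition a_ij per A_ij = per A |a_ij|^p.  Summed down the
   first column it shows that y_i = |a_i1|^p is a stochastic vector.  Expanding
   per A along the first column, the minor A_i1 has rows of l_p-norm
   (1 - y_k)^(1/p), k <> i, so by homogeneity
   |per A_i1| <= U(n-1,p) prod_(k <> i) (1 - y_k)^(1/p).  Hence
   U(n,p) = per A <= U(n-1,p) P_n(y) <= U(n-1,p) w(n,p), and induction on n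
   concludes (the case n = 0 holds as well, both sides being 1). *)

Section Permanent.
Variable R : realType.

Definition per_minor n (A : 'M[R]_n) i j := permanent (row' i (col' j A)).

Lemma per_minorE n (A : 'M[R]_n) i j :
  per_minor A i j = \sum_(s : 'S_n | s i == j) \prod_(k | i != k) A k (s k).
Proof.
case: n A i j => [|n] A i0 j0; first by case: i0.
rewrite (reindex (lift_perm i0 j0)); last first.
  pose ulsf i (s : 'S_n.+1) k := odflt k (unlift (s i) (s (lift i k))).
  have ulsfK i (s : 'S_n.+1) k: lift (s i) (ulsf i s k) = s (lift i k).
    rewrite /ulsf; have:= neq_lift i k.
    by rewrite -(can_eq (permK s)) => /unlift_some[] ? ? ->.
  have inj_ulsf: injective (ulsf i0 _).
    move=> s; apply: can_inj (ulsf (s i0) s^-1%g) _ => k'.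
    by rewrite {1}/ulsf ulsfK !permK liftK.
  exists (fun s => perm (inj_ulsf s)) => [s _ | s].
    by apply/permP=> k'; rewrite permE /ulsf lift_perm_lift lift_perm_id liftK.
  move/(s _ =P _) => si0; apply/permP=> k.
  case: (unliftP i0 k) => [k'|] ->; rewrite ?lift_perm_id //.
  by rewrite lift_perm_lift -si0 permE ulsfK.
rewrite /per_minor /permanent /=.
apply: eq_big => [s | s _]; first by rewrite lift_perm_id eqxx.
case: (pickP 'I_n) => [k0 _ | n0]; last first.
  by rewrite !big1 // => [j /unlift_some[i] | i _]; have:= n0 i.
rewrite (reindex (lift i0)).
  by apply: eq_big => [k | k _] /=; rewrite ?neq_lift // !mxE lift_perm_lift.
exists (fun k => odflt k0 (unlift i0 k)) => k; first by rewrite liftK.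
by case/unlift_some=> k' -> ->.
Qed.

Lemma expand_per_row n (A : 'M[R]_n) i0 :
  permanent A = \sum_j A i0 j * per_minor A i0 j.
Proof.
rewrite /permanent (partition_big (fun s : 'S_n => s i0) predT) //=.
apply: eq_bigr => j0 _; rewrite per_minorE big_distrr /=.
apply: eq_bigr => s /eqP Dsi0.
rewrite (bigID (pred1 i0)) /= big_pred1_eq Dsi0; congr (_ * _).
by apply: eq_bigl => i; rewrite eq_sym.
Qed.

Lemma permanent_tr n (A : 'M[R]_n) : permanent A^T = permanent A.
Proof.
rewrite /permanent [in LHS](reindex_inj (@invg_inj _ : injective (fun s : 'S_n => s^-1)%g)) /=.
apply: eq_bigr => s _; rewrite (reindex_perm s) /=.
by apply: eq_bigr => i _; rewrite mxE permK.
Qed.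

Lemma per_minor_tr n (A : 'M[R]_n) i j : per_minor A^T i j = per_minor A j i.
Proof. by rewrite /per_minor -permanent_tr; congr permanent; apply/matrixP => k l; rewrite !mxE. Qed.

Lemma expand_per_col n (A : 'M[R]_n) j0 :
  permanent A = \sum_i A i j0 * per_minor A i j0.
Proof.
rewrite -permanent_tr (expand_per_row _ j0).
by under eq_bigr do rewrite per_minor_tr mxE.
Qed.

Lemma permanent1 n : permanent (1%:M : 'M[R]_n) = 1.
Proof.
rewrite /permanent (bigD1 (1%g : 'S_n)) //= big1 => [|i _]; last by rewrite perm1 !mxE eqxx.
rewrite big1 ?addr0 // => s s1.
have [i si] : exists i, s i != i.
  apply/existsP; apply: contraR s1 => /existsPn s1; apply/eqP/permP => i.
  by rewrite perm1; apply/eqP; have := s1 i; rewrite negbK.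
by rewrite (bigD1 i) //= !mxE eq_sym (negPf si) mul0r.
Qed.

Lemma permanent_scale_rows n (c : 'I_n -> R) (A : 'M[R]_n) :
  permanent (\matrix_(i, j) (c i * A i j)) = \prod_i c i * permanent A.
Proof.
rewrite /permanent mulr_sumr; apply: eq_bigr => s _.
by rewrite -big_split; apply: eq_bigr => i _; rewrite mxE.
Qed.

Definition set_row n (A : 'M[R]_n) i0 (v : 'I_n -> R) : 'M[R]_n :=
  \matrix_(i, j) if i == i0 then v j else A i j.

Lemma permanent_set_row n (A : 'M[R]_n) i0 v :
  permanent (set_row A i0 v) = \sum_j v j * per_minor A i0 j.
Proof.
rewrite (expand_per_row _ i0); apply: eq_bigr => j _; rewrite mxE eqxx.
congr (_ * permanent _); apply/matrixP => k l.
by rewrite !mxE eq_sym (negPf (neq_lift i0 k)).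
Qed.

End Permanent.

Section RealFacts.
Variable R : realType.

Lemma powR_le1 (x r : R) : 0 <= x <= 1 -> 0 <= r -> x `^ r <= 1.
Proof.
case/andP => x_ge0 x_le1 r_ge0.
by have := @ge0_ler_powR R r r_ge0 x 1; rewrite powR1; apply; rewrite ?nnegrE.
Qed.

Lemma prod_neq_lift n (F : 'I_n.+1 -> R) (i : 'I_n.+1) :
  \prod_(j < n.+1 | j != i) F j = \prod_(k < n) F (lift i k).
Proof.
rewrite big_mkcond (bigD1_ord i) //= eqxx mul1r; apply: eq_bigr => k _.
by rewrite eq_sym neq_lift.
Qed.

Lemma continuous_sum (T : topologicalType) (I : finType) (F : I -> T -> R) :
  (forall i, continuous (F i)) -> continuous (fun x => \sum_i F i x).
Proof.
move=> F_cont; rewrite -fct_sumE.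
apply: (big_ind (fun f : T -> R => continuous f)) => [|f g f_cont g_cont x|i _] //.
  exact: cst_continuous.
by apply: continuousD; [exact: f_cont | exact: g_cont].
Qed.

Lemma continuous_prod (T : topologicalType) (I : finType) (F : I -> T -> R) :
  (forall i, continuous (F i)) -> continuous (fun x => \prod_i F i x).
Proof.
move=> F_cont; rewrite -fct_prodE.
apply: (big_ind (fun f : T -> R => continuous f)) => [|f g f_cont g_cont x|i _] //.
  exact: cst_continuous.
by apply: continuousM; [exact: f_cont | exact: g_cont].
Qed.

Lemma is_derive_comp (f g : R -> R) (x df dg : R) :
  is_derive x 1 f df -> is_derive (f x) 1 g dg -> is_derive x 1 (g \o f) (dg * df).
Proof.
move=> f_df g_dg.
have f_der := @ex_derive _ _ _ _ _ _ _ f_df; have g_der := @ex_derive _ _ _ _ _ _ _ g_dg.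
apply: DeriveDef; first by apply/derivable1_diffP/differentiable_comp; exact/derivable1_diffP.
by rewrite -derive1E derive1_comp // !derive1E !derive_val.
Qed.

Lemma is_derive_affine (a b x : R) : is_derive x 1 (fun y => a + b * y) b.
Proof.
have -> : (fun y => a + b * y) = cst a + b \*: id by apply/funext.
by apply: is_derive_eq; rewrite add0r [LHS]mulr1.
Qed.

(* Multiplying an entry a of a unit-row matrix by e^t, with s = |a|^p and b the
   product of a with its permanental minor, turns the permanent M into
   M + (e^t - 1) b and the p-th power of the row norm into 1 - s + s e^(pt).  If M
   remains maximal after renormalising the row, the difference of the two sides
   below is maximal at t = 0, so its derivative b - M s vanishes there. *)
Lemma rescaling_stationary (p M b s : R) : 0 < p -> 0 < s <= 1 ->
  (forall t, M + (expR t - 1) * b <= M * (1 - s + s * expR (p * t)) `^ (1 / p)) ->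
  b = M * s.
Proof.
move=> p_gt0 /andP[s_gt0 s_le1] le_M.
(* affine maps are written [a + b * x] to fit [is_derive_affine] *)
pose N := (fun x => (1 - s) + s * x) \o expR \o (fun t => 0 + p * t).
have N_gt0 t : 0 < N t by rewrite ltr_pwDr ?mulr_gt0 ?expR_gt0 ?subr_ge0.
pose G := expR \o (fun x => 0 + (1 / p) * x) \o (@ln R) \o N.
pose f := ((fun x => (M - b) + b * x) \o expR) + ((fun x => 0 + - M * x) \o G).
have f_le_f0 t : f t <= f 0.
  have -> : f 0 = 0.
    by rewrite /f /G /N !fctE /= !add0r !mulr0 !expR0 !mulr1 !subrK ln1 mulr0 expR0; ring.
  have -> : f t = M + (expR t - 1) * b - M * expR (1 / p * ln (N t)).
    by rewrite /f /G !fctE /= !add0r; ring.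
  rewrite subr_le0 [1 / p * _]mulrC expRM lnK; last by rewrite posrE.
  by rewrite /N /= add0r; exact: le_M.
have N_der (t : R) := is_derive_comp (is_derive_affine 0 p t)
  (is_derive_comp (is_derive_expR _) (is_derive_affine (1 - s) s _)).
have G_der (t : R) := is_derive_comp (N_der t) (is_derive_comp (is_derive1_ln (N_gt0 t))
  (is_derive_comp (is_derive_affine 0 (1 / p) _) (is_derive_expR _))).
have f_der (t : R) := is_deriveD
  (is_derive_comp (is_derive_expR t) (is_derive_affine (M - b) b _))
  (is_derive_comp (G_der t) (is_derive_affine 0 (- M) _)).
have f'0 : is_derive (0 : R) (1 : R) f 0.
  apply: (@derive1_at_max _ f (-1) 1 0) => [|t _||t _]; last exact: f_le_f0.
  - by lra.
  - exact: (@ex_derive _ _ _ _ _ _ _ (f_der t)).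
  - by rewrite in_itv /= ltrN10 ltr01.
have := @derive_val _ _ _ _ _ _ _ (f_der 0); rewrite (@derive_val _ _ _ _ _ _ _ f'0).
have -> : N 0 = 1 by rewrite /N /= mulr0 add0r expR0 mulr1 subrK.
rewrite ln1 mulr0 add0r expR0 mulr0 add0r expR0 invr1 !mulr1 !mul1r.
move/eqP; rewrite eq_sym addr_eq0 => /eqP ->.
by field; exact: lt0r_neq0.
Qed.

End RealFacts.

Section PermanentBound.
Variables (R : realType) (p : R).
Hypothesis p_ge1 : 1 <= p.

Let p_gt0 : 0 < p. Proof. exact: lt_le_trans ltr01 p_ge1. Qed.
Let p_neq0 : p != 0. Proof. exact: lt0r_neq0. Qed.
Let mulpVp : (1 / p) * p = 1. Proof. by rewrite mul1r mulVf. Qed.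
Let powRpK x : 0 <= x -> (x `^ p) `^ (1 / p) = x.
Proof. by move=> x_ge0; rewrite -powRrM mulrC mulpVp powRr1. Qed.

Definition unit_rows n (A : 'M[R]_n) := forall i, \sum_j `|A i j| `^ p = 1.

Lemma row_lp_norm_eq1 n (A : 'M[R]_n) i :
  row_lp_norm p A i = 1 <-> \sum_j `|A i j| `^ p = 1.
Proof.
rewrite /row_lp_norm; split=> [/eqP|->]; last by rewrite powR1.
rewrite powR_eq1 mul1r invr_eq0 (negPf p_neq0) orbF => /orP[/eqP //|].
by rewrite ltNge sumr_ge0 // => j _; exact: powR_ge0.
Qed.

Let per_unit_rows n := [set permanent A | A in [set A : 'M[R]_n | unit_rows A]].

Lemma UE n : U n p = sup (per_unit_rows n).
Proof.
rewrite /U /per_unit_rows; congr (sup (image _ _)); apply/seteqP.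
by split=> A /= rowsA i; apply/row_lp_norm_eq1.
Qed.

Lemma unit_rows_entry_le1 n (A : 'M[R]_n) i j : unit_rows A -> `|A i j| <= 1.
Proof.
move=> /(_ i) rowA; rewrite leNgt; apply/negP => Aij_gt1.
have : 1 < `|A i j| `^ p := lt_le_trans Aij_gt1 (le1r_powR (ltW Aij_gt1) p_ge1).
rewrite ltNge -rowA (bigD1 j) //= lerDl sumr_ge0 // => k _; exact: powR_ge0.
Qed.

Lemma norm_permanent_le_fact n (A : 'M[R]_n) :
  (forall i j, `|A i j| <= 1) -> `|permanent A| <= n`!%:R.
Proof.
move=> A_le1; apply: le_trans (ler_norm_sum _ _ _) _.
rewrite -card_Sn -sumr_const; apply: ler_sum => s _.
by rewrite normr_prod; apply: prodr_ile1 => i _; rewrite normr_ge0 A_le1.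
Qed.

Lemma unit_rows1 n : unit_rows (1%:M : 'M[R]_n).
Proof.
move=> i; rewrite (bigD1 i) //= big1 => [|j /negPf ji].
  by rewrite !mxE eqxx normr1 powR1 addr0.
by rewrite !mxE eq_sym ji normr0 powR0.
Qed.

Lemma has_sup_per_unit_rows n : has_sup (per_unit_rows n).
Proof.
split; first by exists 1, 1%:M; [exact: unit_rows1 | exact: permanent1].
exists n`!%:R => _ [A rowsA <-]; apply: le_trans (ler_norm _) _.
by apply: norm_permanent_le_fact => i j; exact: unit_rows_entry_le1.
Qed.

Lemma permanent_le_U n (A : 'M[R]_n) : unit_rows A -> permanent A <= U n p.
Proof.
by move=> rowsA; rewrite UE; apply: sup_upper_bound (has_sup_per_unit_rows n) _ _; exists A.
Qed.

Lemma U_le n x : (forall A : 'M[R]_n, unit_rows A -> permanent A <= x) -> U n p <= x.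
Proof.
move=> per_le; rewrite UE; apply: ge_sup => [|_ [A rowsA <-]]; last exact: per_le.
by exists 1, 1%:M; [exact: unit_rows1 | exact: permanent1].
Qed.

Lemma U_ge1 n : 1 <= U n p.
Proof. by rewrite -(permanent1 R n); apply/permanent_le_U/unit_rows1. Qed.

Lemma U0 : U 0 p = 1.
Proof.
apply/eqP; rewrite eq_le U_ge1 andbT; apply: U_le => A _.
by rewrite (_ : A = 1%:M) ?permanent1 //; apply/matrixP => -[].
Qed.

Lemma norm_permanent_le_U n (A : 'M[R]_n) : unit_rows A -> `|permanent A| <= U n p.
Proof.
move=> rowsA; have [per_ge0|per_lt0] := leP 0 (permanent A).
  by rewrite ger0_norm //; exact: permanent_le_U.
case: n A rowsA per_lt0 => [|n] A rowsA per_lt0.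
  by move: per_lt0; rewrite (_ : A = 1%:M) ?permanent1 ?ltr10 //; apply/matrixP => -[].
pose c (i : 'I_n.+1) : R := (-1) ^+ (i == ord0).
have prod_c : \prod_i c i = -1.
  by rewrite (bigD1 ord0) //= big1 => [|i /negPf i0]; rewrite /c ?i0 ?mulr1.
rewrite ltr0_norm // -mulN1r -prod_c -permanent_scale_rows.
apply: permanent_le_U => i; rewrite -(rowsA i); apply: eq_bigr => j _.
by rewrite mxE normrM normrX normrN1 expr1n mul1r.
Qed.

Lemma norm_permanent_le_U_row_norms n (B : 'M[R]_n) :
  `|permanent B| <= U n p * \prod_i (\sum_j `|B i j| `^ p) `^ (1 / p).
Proof.
have U_ge0 : 0 <= U n p := le_trans ler01 (U_ge1 n).
pose N i := \sum_j `|B i j| `^ p.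
have N_ge0 i : 0 <= N i by apply: sumr_ge0 => j _; exact: powR_ge0.
have [i0 /eqP N0|N_neq0] := pickP (fun i => N i == 0).
  have B0 j : B i0 j = 0.
    have := @psumr_eq0P _ _ xpredT _ (fun j _ => powR_ge0 `|B i0 j| p) N0 j isT.
    by move/powR_eq0_eq0/normr0_eq0.
  rewrite /permanent big1 ?normr0 ?mulr_ge0 ?prodr_ge0 // => [i _|s _].
    exact: powR_ge0.
  by rewrite (bigD1 i0) //= B0 mul0r.
pose c i := N i `^ (1 / p).
have c_gt0 i : 0 < c i by rewrite powR_gt0 // lt0r N_neq0 N_ge0.
pose B' := \matrix_(i, j) ((c i)^-1 * B i j).
have c_ge0 i : 0 <= c i := ltW (c_gt0 i).
have -> : permanent B = \prod_i c i * permanent B'.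
  rewrite -permanent_scale_rows; congr permanent; apply/matrixP => i j.
  by rewrite !mxE mulrA mulfV ?mul1r // lt0r_neq0.
rewrite normrM ger0_norm ?prodr_ge0 // mulrC; apply: ler_wpM2r; first exact: prodr_ge0.
apply: norm_permanent_le_U => i.
have cVp : (c i)^-1 `^ p = (N i)^-1.
  by rewrite -powRN -powRrM mulNr mulpVp powR_inv1.
under eq_bigr do rewrite mxE normrM powRM // ger0_norm ?invr_ge0 // cVp.
by rewrite -mulr_sumr mulVf // (N_neq0 i).
Qed.

Lemma continuous_normr_powR : continuous (fun x : R => `|x| `^ p).
Proof.
move=> x; have [->|x_neq0] := eqVneq x 0.
  apply/cvgrPdist_le => e e_gt0; near=> y.
  rewrite normr0 powR0 // sub0r normrN ger0_norm ?powR_ge0 //.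
  have y_le1 : `|y| <= 1.
    by near: y; exists 1 => //= z; rewrite /ball_ /= sub0r normrN => /ltW.
  have y_le_e : `|y| <= e.
    by near: y; exists e => //= z; rewrite /ball_ /= sub0r normrN => /ltW.
  have [->|y_neq0] := eqVneq y 0; first by rewrite normr0 powR0 // ltW.
  apply: le_trans y_le_e; apply: ge1r_powR => //; by rewrite normr_gt0 y_neq0.
apply: (@continuous_comp _ _ _ (@Num.norm _ R) (fun a => a `^ p)).
  exact: norm_continuous.
apply: differentiable_continuous; apply/derivable1_diffP.
by apply: derivable_powR; rewrite in_itv /= normr_gt0 x_neq0.
Unshelve. all: by end_near.
Qed.

Lemma exists_permanent_max n : exists2 A : 'M[R]_n, unit_rows A &
  forall B : 'M[R]_n, unit_rows B -> permanent B <= permanent A.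
Proof.
(* compactness of bounded closed sets is available for row vectors *)
pose K := [set v : 'rV[R]_(n * n) | unit_rows (vec_mx v)].
have K_neq0 : K !=set0 by exists (mxvec 1%:M); rewrite /K /= mxvecK; exact: unit_rows1.
pose g (i : 'I_n) (v : 'rV[R]_(n * n)) := \sum_j `|v ord0 (mxvec_index i j)| `^ p.
have KE : K = \bigcap_(i in setT) (g i @^-1` [set 1]).
  have gE i v : g i v = \sum_j `|vec_mx v i j| `^ p.
    by apply: eq_bigr => j _; rewrite mxE.
  apply/seteqP; split => v /= Kv i; first by move=> _; rewrite /preimage /= gE; exact: Kv.
  by rewrite -gE; exact: Kv.
have K_compact : compact K.
  apply: bounded_closed_compact.
    rewrite /bounded_set /bounded_near; near=> M => v Kv /=.
    have M_ge1 : 1 <= M by near: M; apply: nbhs_pinfty_ge; rewrite realE ler01.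
    apply: le_trans M_ge1; rewrite /Num.norm /= mx_normrE.
    apply/bigmax_leP; split => //= -[a k] _ /=; rewrite ord1.
    by case/mxvec_indexP: k => i j; have := unit_rows_entry_le1 i j Kv; rewrite mxE.
  rewrite KE; apply: closed_bigI => i _; apply: preimage_closed; last exact: closed_eq.
  move=> v _; apply: continuous_sum => j w.
  apply: (@continuous_comp _ _ _ (fun w : 'rV[R]_(n * n) => w ord0 (mxvec_index i j))
    (fun x : R => `|x| `^ p) w).
    exact: coord_continuous.
  exact: continuous_normr_powR.
have per_cont : {within K, continuous (fun v => permanent (vec_mx v))}.
  apply: continuous_subspaceT.
  have -> : (fun v : 'rV[R]_(n * n) => permanent (vec_mx v)) =
      fun v => \sum_(s : 'S_n) \prod_i v ord0 (mxvec_index i (s i)).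
    by apply/funext => v; apply: eq_bigr => s _; apply: eq_bigr => i _; rewrite mxE.
  by apply: continuous_sum => s; apply: continuous_prod => i; exact: coord_continuous.
have [v Kv v_max] := EVT_max_rV K_neq0 K_compact per_cont.
exists (vec_mx v); first by move: Kv; rewrite inE.
by move=> B rowsB; have := v_max (mxvec B); rewrite mxvecK; apply; rewrite inE /K /= mxvecK.
Unshelve. all: by end_near.
Qed.

Lemma sum_powR_rescale_entry n (A : 'M[R]_n) i j (c t : R) : unit_rows A -> 0 < c ->
  \sum_l `|c * (if l == j then A i j * expR t else A i l)| `^ p
    = c `^ p * (1 - `|A i j| `^ p + `|A i j| `^ p * expR (p * t)).
Proof.
move=> rowsA c_gt0; have c_ge0 := ltW c_gt0.
have rest : \sum_(l | l != j) `|A i l| `^ p = 1 - `|A i j| `^ p.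
  by rewrite -(rowsA i) [in RHS](bigD1 j) //=; ring.
rewrite (bigD1 j) //= eqxx -rest mulrDr [in RHS]addrC; congr (_ + _).
  rewrite !normrM (gtr0_norm c_gt0) (gtr0_norm (expR_gt0 t)).
  rewrite !powRM ?mulr_ge0 ?normr_ge0 ?expR_ge0 //.
  by rewrite -expRM (mulrC t p) mulrA.
rewrite mulr_sumr; apply: eq_bigr => l /negPf ->.
by rewrite normrM powRM ?normr_ge0 // gtr0_norm.
Qed.

Lemma permanent_max_stationary n (A : 'M[R]_n) : unit_rows A ->
  (forall B : 'M[R]_n, unit_rows B -> permanent B <= permanent A) ->
  forall i j, A i j * per_minor A i j = permanent A * `|A i j| `^ p.
Proof.
move=> rowsA A_max i j.
have [->|Aij_neq0] := eqVneq (A i j) 0; first by rewrite mul0r normr0 powR0 ?mulr0 ?gt_eqF.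
set M := permanent A; set b := A i j * per_minor A i j; set s := `|A i j| `^ p.
have s_gt0 : 0 < s by rewrite powR_gt0 // normr_gt0.
have s_le1 : s <= 1.
  by rewrite -(rowsA i) (bigD1 j) //= lerDl sumr_ge0 // => k _; exact: powR_ge0.
apply: (rescaling_stationary p_gt0); first by rewrite s_gt0 s_le1.
move=> t; pose N := 1 - s + s * expR (p * t).
have N_gt0 : 0 < N by rewrite ltr_pwDr ?mulr_gt0 ?expR_gt0 ?subr_ge0.
pose c := N `^ (- (1 / p)).
have c_gt0 : 0 < c := powR_gt0 _ N_gt0.
pose v k := c * (if k == j then A i j * expR t else A i k).
have per_v : permanent (set_row A i v) = c * (M + (expR t - 1) * b).
  rewrite permanent_set_row /M (expand_per_row A i).
  rewrite [LHS](bigD1 j) // [X in _ = c * (X + _)](bigD1 j) //= /v eqxx.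
  have -> : \sum_(k | k != j) c * (if k == j then A i j * expR t else A i k) * per_minor A i k
      = c * \sum_(k | k != j) A i k * per_minor A i k.
    by rewrite mulr_sumr; apply: eq_bigr => k /negPf ->; rewrite mulrA.
  by rewrite /b; ring.
have rows_v : unit_rows (set_row A i v).
  move=> k; have [->|k_neq_i] := eqVneq k i; last first.
    by rewrite -(rowsA k); apply: eq_bigr => l _; rewrite mxE (negPf k_neq_i).
  under eq_bigr do rewrite mxE eqxx.
  rewrite sum_powR_rescale_entry // -/s -/N.
  by rewrite -powRrM mulNr mulpVp powR_inv1 ?mulVf ?gt_eqF // ltW.
have := A_max _ rows_v; rewrite per_v /c powRN ler_pdivrMl ?powR_gt0 //.
by rewrite [_ * permanent A]mulrC.
Qed.

Lemma stochastic_le1 k (y : 'rV[R]_k) i : stochastic y -> 0 <= y ord0 i <= 1.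
Proof. by case=> y_ge0 y_sum1; rewrite y_ge0 -y_sum1 (bigD1 i) //= lerDl sumr_ge0. Qed.

Lemma Pk_ge0 k (y : 'rV[R]_k) : 0 <= Pk p y.
Proof. by apply: sumr_ge0 => i _; rewrite mulr_ge0 ?prodr_ge0 // => *; exact: powR_ge0. Qed.

Lemma Pk_le_w k (y : 'rV[R]_k) : stochastic y -> Pk p y <= w k p.
Proof.
have q_ge0 : 0 <= 1 / p by rewrite divr_ge0 ?ler01 ?ltW.
move=> y_stoch; apply: sup_upper_bound; last by exists y.
split; first by exists (Pk p y), y.
exists k%:R => _ [z z_stoch <-]; rewrite /Pk -[k in k%:R]card_ord -sumr_const.
apply: ler_sum => i _; apply: mulr_ile1.
- exact: powR_ge0.
- by apply: prodr_ge0 => j _; exact: powR_ge0.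
- exact: powR_le1 (stochastic_le1 i z_stoch) q_ge0.
apply: prodr_ile1 => j _; rewrite powR_ge0 powR_le1 //.
by have /andP[z_ge0 z_le1] := stochastic_le1 j z_stoch; rewrite subr_ge0 z_le1 gerBl.
Qed.

Lemma w_ge0 k : 0 <= w k.+1 p.
Proof.
pose e : 'rV[R]_k.+1 := \row_j (j == ord0)%:R.
have e_stoch : stochastic e.
  split=> [i|]; first by rewrite mxE ler0n.
  by rewrite (bigD1 ord0) //= big1 => [|j /negPf j_neq0]; rewrite mxE ?eqxx ?addr0 ?j_neq0.
exact: le_trans (Pk_ge0 e) (Pk_le_w e_stoch).
Qed.

Lemma U_succ_le n : U n.+1 p <= U n p * w n.+1 p.
Proof.
have U_ge0 : 0 <= U n p := le_trans ler01 (U_ge1 n).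
have [A rowsA A_max] := exists_permanent_max n.+1.
have M_gt0 : 0 < permanent A.
  by apply: lt_le_trans ltr01 _; rewrite -(permanent1 R n.+1); exact/A_max/unit_rows1.
have A_stat := permanent_max_stationary rowsA A_max.
pose y : 'rV[R]_n.+1 := \row_i `|A i ord0| `^ p.
have y_stoch : stochastic y.
  (* sum the stationarity condition down the first column *)
  split => [i|]; first by rewrite mxE powR_ge0.
  apply: (mulfI (lt0r_neq0 M_gt0)); rewrite mulr1 [in RHS](expand_per_col A ord0) mulr_sumr.
  by apply: eq_bigr => i _; rewrite A_stat mxE.
apply: le_trans (U_le A_max) _.
apply: le_trans (ler_wpM2l U_ge0 (Pk_le_w y_stoch)).
rewrite (expand_per_col A ord0) /Pk mulr_sumr; apply: ler_sum => i _.
apply: le_trans (ler_norm _) _; rewrite normrM mxE powRpK // mulrCA.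
(* row [k] of the minor is row [lift i k] of [A] without its first entry *)
apply: ler_wpM2l => //; rewrite prod_neq_lift.
have -> : \prod_k (1 - y ord0 (lift i k)) `^ (1 / p) =
    \prod_k (\sum_l `|row' i (col' ord0 A) k l| `^ p) `^ (1 / p).
  apply: eq_bigr => k _; rewrite mxE -(rowsA (lift i k)) (bigD1_ord ord0) //= addrC addrK.
  by congr (_ `^ _); apply: eq_bigr => l _; rewrite !mxE.
exact: norm_permanent_le_U_row_norms.
Qed.

Lemma U_le_prod_w n : U n p <= \prod_(1 <= k < n.+1) w k p.
Proof.
elim: n => [|n IH]; first by rewrite U0 // big_geq.
apply: le_trans (U_succ_le n) _; rewrite big_nat_recr //=.
by apply: ler_wpM2r => //; exact: w_ge0.
Qed.

End PermanentBound.

Unset Implicit Arguments.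

Theorem theorem2p1 (R : realType) (n : nat) (p : R) :
  1 <= p -> (1 <= n)%N ->
  U n p <= \prod_(1 <= k < n.+1) w k p.
Proof. by move=> p_ge1 _; exact: U_le_prod_w. Qed.
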